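(* For all $I,J\subseteq N$, $$\Psi_I\Psi_J\ge\Psi_{I\cup J}\Psi_{I\cap J}.$$ Let $\mathcal P(z)=\sum_{I\subseteq N}\Psi_I\prod_{i\in I}z_i$. After normalization by $\mathcal P(1,\dots,1)$, the coefficients define a strongly Rayleigh probability measure on subsets of $N$ (the measure assigning to $I\subseteq N$ the mass $\Psi_I/\mathcal P(1,\dots,1)$).
   Context: Network. $G=(V,E)$ is a finite connected simple undirected graph; each edge $e$ has a conductance $c_e\in\mathbb R_{>0}$. A spanning forest $F$ of $G$ is an acyclic subgraph with vertex set $V$ (isolated vertices allowed); $w(F)=\prod_{e\in F}c_e$; $\mathcal F_m$ is the set of spanning forests with exactly $m$ connected components. Superports. The boundary $M\subseteq V$ is nonempty and partitioned into nonempty superports $M=A_1\sqcup\cdots\sqcup A_p$. Choose a root $r_a\in A_a$ for each $a$; $R=\{r_1,\dots,r_p\}$, $N=M\setminus R$, $q=|N|$; $r(x)$ is the root of the superport containing $x$. Valid forests. A spanning forest is valid if identifying all boundary vertices within each superport (one vertex per superport) turns it into a spanning tree of the quotient network (loops and parallel edges count as cycles). $\Phi_{\mathrm{valid}}=\sum_{F\text{ valid}}w(F)$. Quotient port graph and principal numerators. For a spanning forest $F$, the quotient port multigraph $H_F$ has the connected components of $F$ as vertices, and each $x\in N$ gives a directed edge from the component containing $r(x)$ to the component containing $x$ (a loop if these coincide). For $I\subseteq N$ with $|I|=k$, $\Psi_I$ is the sum of $w(F)$ over those $F\in\mathcal F_{q-k+1}$ for which the edge set $N\setminus I$ is a spanning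 tree of $H_F$; $\Psi_\varnothing:=\Phi_{\mathrm{valid}}$. A probability measure $\mu$ on subsets of $N$ is strongly Rayleigh if its generating polynomial $\sum_{I\subseteq N}\mu(I)\prod_{i\in I}z_i$ is real stable, i.e. has no zero $z\in\mathbb C^N$ with $\operatorname{Im}z_i>0$ for all $i$. *)

(* Defs.v *)
From HB Require Import structures.
From mathcomp Require Import all_boot all_order all_algebra.
From mathcomp Require Import boolp reals complex.

Set Implicit Arguments.
Unset Strict Implicit.
Unset Printing Implicit Defensive.

Import Order.TTheory GRing.Theory Num.Theory.
Local Open Scope ring_scope.

(* A multigraph with vertices in T and edges labelled by D is given by         *)
(* [ends : D -> {set T}], the set of endpoints of each edge; it is a singleton *)
(* exactly for loops, and parallel edges are distinct labels with equal ends.  *)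
Section Multigraph.
Variables (T D : finType) (ends : D -> {set T}).

Definition adj (S : {set D}) : rel T :=
  [rel x y | [exists d in S, ends d == [set x; y]]].

(* A cycle is listed as the pairs (v_i, d_i) where the edge d_i joins v_i to   *)
(* the next vertex v_(i+1), cyclically: length 1 is a loop, and length 2 a     *)
(* pair of parallel edges.                                                     *)
Definition is_cycle (S : {set D}) (s : seq (T * D)) : bool :=
  [&& s != [::], uniq (unzip1 s), uniq (unzip2 s),
      all (mem S) (unzip2 s)
    & path.cycle [rel a b : T * D | ends a.2 == [set a.1; b.1]] s].

Definition acyclic (S : {set D}) : bool :=
  `[< forall s, ~~ is_cycle S s >].

Definition spanning_tree (W : {set T}) (S : {set D}) : bool :=
  acyclic S && [forall x in W, forall y in W, connect (adj S) x y].

End Multigraph.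

(* A simple graph on V is a set E of two-element subsets of V, so that each    *)
(* edge is its own set of endpoints and [ends] is the identity.                *)
Section Network.
Variables (R : realType) (V : finType) (E : {set {set V}}) (c : {set V} -> R).

Definition simple_graph : Prop := {in E, forall e : {set V}, #|e| = 2%N}.

Definition connected_graph : Prop := forall x y : V, connect (adj id E) x y.

Definition spanning_forest (F : {set {set V}}) : bool :=
  (F \subset E) && acyclic id F.

Definition component (F : {set {set V}}) (x : V) : {set V} :=
  [set y | connect (adj id F) x y].

Definition components (F : {set {set V}}) : {set {set V}} :=
  [set component F x | x in [set: V]].

Definition weight (F : {set {set V}}) : R := \prod_(e in F) c e.

(* P is the set of superports, a partition of the boundary M, and [rt B] is    *)
(* the root of the superport B.                                                *)
Variables (M : {set V}) (P : {set {set V}}) (rt : {set V} -> V).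

Definition nonroots : {set V} := M :\: rt @: P.

Definition root_of (x : V) : V := rt (pblock P x).

Definition quot (x : V) : {set V} :=
  if x \in M then pblock P x else [set x].

Definition valid (F : {set {set V}}) : bool :=
  spanning_forest F &&
  spanning_tree (fun e : {set V} => quot @: e) (quot @: [set: V]) F.

Definition Phi_valid : R := \sum_(F | valid F) weight F.

(* Endpoints in H_F of the edge labelled x; its direction plays no role in     *)
(* being a spanning tree.                                                      *)
Definition port_ends (F : {set {set V}}) (x : V) : {set {set V}} :=
  [set component F (root_of x); component F x].

Definition Psi (I : {set V}) : R :=
  if I == set0 then Phi_valid else
  \sum_(F | [&& spanning_forest F,
                #|components F| == (#|nonroots| - #|I| + 1)%N
              & spanning_tree (port_ends F) (components F) (nonroots :\: I)])
     weight F.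

End Network.

(* Value at z of the multiaffine polynomial in the variables (z_i)_(i in N)    *)
(* with coefficients a.                                                        *)
Definition gen_poly (K : comNzRingType) (V : finType) (N : {set V})
    (a : {set V} -> K) (z : V -> K) : K :=
  \sum_(I : {set V} | I \subset N) a I * \prod_(i in I) z i.

Section StronglyRayleigh.
Variables (R : realType) (V : finType) (N : {set V}) (mu : {set V} -> R).

Definition probability_on_subsets : Prop :=
  (forall I : {set V}, I \subset N -> 0 <= mu I) /\
  \sum_(I : {set V} | I \subset N) mu I = 1.

Definition real_stable : Prop :=
  forall z : V -> R[i], {in N, forall i, 0 < complex.Im (z i)} ->
    gen_poly N (fun I => (mu I)%:C%C) z != 0.

Definition strongly_Rayleigh : Prop := probability_on_subsets /\ real_stable.

End StronglyRayleigh.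

(* Main.v *)
(* Add to G one edge from each x in N to the root of its superport. A forest F
   counted by Psi_I is exactly the trace on E of a spanning tree of the enlarged
   graph whose set of added edges is N \ I, so sum_I Psi_I z^I is, up to the
   monomial z^N, the spanning tree polynomial of this graph at 1/z on the added
   edges. By the matrix-tree theorem that polynomial is the determinant of a
   grounded Laplacian, whose quadratic form has no kernel when the added weights
   lie in the lower half-plane: this is real stability. Specializing to two
   free variables, with weight 0 or 1/e (e -> 0) on the other added edges, gives
   the Rayleigh inequality Psi_(S+i) Psi_(S+j) >= Psi_S Psi_(S+i+j), which by
   positivity propagates to log-submodularity on all of 2^N. *)

Require Import Defs.
From HB Require Import structures.
From mathcomp Require Import all_boot all_order all_algebra.
From mathcomp Require Import boolp reals complex.
From mathcomp Require Import perm ring polyrcf.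

Set Implicit Arguments.
Unset Strict Implicit.
Unset Printing Implicit Defensive.

Import Order.TTheory GRing.Theory Num.Theory.
Local Open Scope ring_scope.

(** * Forests in multigraphs *)

Lemma connect_ind (T : finType) (e : rel T) (Q : T -> Prop) (x y : T) :
  (forall u v, Q u -> e u v -> Q v) -> Q x -> connect e x y -> Q y.
Proof.
move=> stepQ Qx /connectP[p]; elim: p x Qx => [|z p IHp] x Qx /=.
  by move=> _ ->.
by move=> /andP[exz pz]; apply: IHp pz; apply: stepQ exz.
Qed.

Section Multigraph.
Variables (T D : finType) (ends : D -> {set T}).
Implicit Types (S A : {set D}) (x y u v : T).

(** [ends d] may be any set of vertices; this cuts it down to one or two endpoints, the case [x = y]
    being a loop. *)
Definition well_formed S : Prop :=
  {in S, forall d, exists x y, ends d = [set x; y]}.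

Definition spanning_connected S : bool :=
  [forall x, forall y, connect (adj ends S) x y].

Definition blocks S : {set {set T}} :=
  [set [set y | connect (adj ends S) x y] | x in [set: T]].

Lemma adj_sym S : symmetric (adj ends S).
Proof.
by move=> x y /=; apply: eq_existsb => d; rewrite (setUC [set x]).
Qed.

Lemma connect_adjC S x y : connect (adj ends S) x y = connect (adj ends S) y x.
Proof. exact: (sym_connect_sym (@adj_sym S)). Qed.

Lemma adj_edge S d x y : d \in S -> ends d = [set x; y] -> adj ends S x y.
Proof. by move=> dS ed; apply/existsP; exists d; rewrite dS ed eqxx. Qed.

Lemma adjP S x y :
  reflect (exists2 d, d \in S & ends d = [set x; y]) (adj ends S x y).
Proof.
apply: (iffP existsP) => [[d /andP[dS /eqP]]|[d dS ed]]; first by exists d.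
by exists d; rewrite dS ed eqxx.
Qed.

Lemma set2_eq (x y u v : T) :
  [set x; y] = [set u; v] -> x = u /\ y = v \/ x = v /\ y = u.
Proof.
move=> e.
have: x \in [set u; v] by rewrite -e !inE eqxx.
have: y \in [set u; v] by rewrite -e !inE eqxx orbT.
have: u \in [set x; y] by rewrite e !inE eqxx.
have: v \in [set x; y] by rewrite e !inE eqxx orbT.
rewrite !inE => /orP[]/eqP h1 /orP[]/eqP h2 /orP[]/eqP h3 /orP[]/eqP h4; subst; auto.
Qed.

Lemma sub_connect S A x y :
  S \subset A -> connect (adj ends S) x y -> connect (adj ends A) x y.
Proof.
move=> sSA; apply: connect_sub => u v /adjP[d dS ed].
by apply/connect1/adj_edge/ed/(subsetP sSA).
Qed.

(** A path need cross the new edge at most once, in one of its two directions. *)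
Lemma connectU1 S d x y u v : ends d = [set x; y] ->
  connect (adj ends (d |: S)) u v =
  [|| connect (adj ends S) u v,
      connect (adj ends S) u x && connect (adj ends S) y v
    | connect (adj ends S) u y && connect (adj ends S) x v].
Proof.
move=> ed; apply/idP/idP; last first.
  have sub a b := @sub_connect S (d |: S) a b (subsetUr _ _).
  have xy : connect (adj ends (d |: S)) x y.
    by apply/connect1/adj_edge/ed/setU11.
  case/or3P => [/sub //|/andP[/sub h1 /sub h2]|/andP[/sub h1 /sub h2]].
    exact: connect_trans (connect_trans h1 xy) h2.
  by rewrite connect_adjC in xy; apply: connect_trans (connect_trans h1 xy) h2.
set e := adj ends S; apply: (connect_ind (Q := fun v => is_true [|| _, _ | _])).
  move=> a b h /adjP[d' /setU1P[->|d'S] ed'].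
    rewrite ed in ed'.
    case: (set2_eq ed') => -[? ?]; subst a b.
      case/or3P: h => [->|/andP[-> _]|/andP[-> _]]; rewrite !connect0 ?orbT //.
    case/or3P: h => [->|/andP[-> _]|/andP[-> _]]; rewrite !connect0 ?orbT //.
  have eab : connect e a b by apply/connect1/adj_edge/ed'.
  case/or3P: h => [h|/andP[h1 h2]|/andP[h1 h2]]; apply/or3P.
  - by apply: Or31; apply: connect_trans eab.
  - by apply: Or32; rewrite h1; apply: connect_trans eab.
  - by apply: Or33; rewrite h1; apply: connect_trans eab.
by rewrite connect0.
Qed.

Lemma connect0E x y : connect (adj ends set0) x y = (x == y).
Proof.
apply/idP/eqP => [|->]; last exact: connect0.
by apply: (connect_ind (Q := fun y => x = y)) => // u v _ /adjP[d]; rewrite inE.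
Qed.

Lemma eq_block S x y :
  [set z | connect (adj ends S) x z] = [set z | connect (adj ends S) y z] <->
  connect (adj ends S) x y.
Proof.
split=> [/setP/(_ y)|cxy]; first by rewrite !inE connect0.
by apply/setP => z; rewrite !inE; apply: (same_connect (@connect_adjC S)).
Qed.

Lemma card_blocks0 : #|blocks set0| = #|T|.
Proof.
rewrite card_in_imset ?cardsT // => x y _ _ /eq_block.
by rewrite connect0E => /eqP.
Qed.

(** The new edge merges the blocks of [x] and [y] if they differ and leaves all other blocks
    alone. *)
Lemma card_blocksU1 S d x y : ends d = [set x; y] ->
  #|blocks S| = (#|blocks (d |: S)| + ~~ connect (adj ends S) x y)%N.
Proof.
move=> ed; pose C u := [set z | connect (adj ends S) u z].
pose C' u := [set z | connect (adj ends (d |: S)) u z].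
have [cxy|ncxy] := boolP (connect (adj ends S) x y).
  rewrite addn0; congr #|pred_of_set _|; apply: eq_imset => u.
  apply/setP => v; rewrite !inE (connectU1 _ _ _ ed).
  apply/idP/or3P => [->|]; first exact: Or31.
  case=> // /andP[h1 h2]; last rewrite connect_adjC in cxy.
    exact: connect_trans (connect_trans h1 cxy) h2.
  exact: connect_trans (connect_trans h1 cxy) h2.
have C'E u : C' u = if (u \in C x) || (u \in C y) then C x :|: C y else C u.
  apply/setP => v; rewrite !inE (connectU1 _ _ _ ed).
  case: ifP => [|/norP[]]; last first.
    rewrite !inE => n1 n2.
    by rewrite (connect_adjC _ u x) (negPf n1) (connect_adjC _ u y) (negPf n2) !orbF.
  rewrite !inE (connect_adjC _ u x) (connect_adjC _ u y).
  case/orP => h.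
    rewrite h -(same_connect (@connect_adjC S) h) /=.
    case: (connect _ x v); first by [].
    by case: (connect _ y v) => //=; rewrite andbF.
  rewrite h -(same_connect (@connect_adjC S) h) /=.
  by case: (connect _ y v); case: (connect _ x v); rewrite ?andbT ?andbF ?orbT.
have xCx u : u \in C u by rewrite inE connect0.
have defB : blocks (d |: S) = (C x :|: C y) |: (blocks S :\ C x :\ C y).
  apply/setP => B; apply/imsetP/setU1P => [[u _ ->]|].
    rewrite -/(C' u) C'E; case: ifP => [_|/norP[n1 n2]]; first by left.
    right; rewrite !inE imset_f ?inE // !andbT.
    apply/andP; split; first by apply: contraNneq n2 => <-.
    by apply: contraNneq n1 => <-.
  case=> [->|]; first by exists x => //; rewrite -/(C' x) C'E xCx.
  rewrite !inE => /and3P[n2 n1 /imsetP[u _ defBu]]; subst B; exists u => //.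
  rewrite -/(C' u) C'E ifN //.
  apply/norP; rewrite !inE; split.
    by apply: contraNN n1 => /eq_block/esym/eqP.
  by apply: contraNN n2 => /eq_block/esym/eqP.
have UnB : C x :|: C y \notin blocks S :\ C x :\ C y.
  rewrite !inE; apply/and3P => -[_ _ /imsetP[u _ defU]].
  have: x \in C x :|: C y by rewrite inE xCx.
  have: y \in C x :|: C y by rewrite inE xCx orbT.
  rewrite defU !inE connect_adjC => h1 h2.
  by rewrite connect_adjC (connect_trans h1 h2) in ncxy.
rewrite defB cardsU1 UnB (cardsD1 (C x) (blocks S)) (cardsD1 (C y) (_ :\ C x)).
rewrite !inE !imset_f ?inE // andbT.
have -> : C y != C x by apply: contraNneq ncxy => /esym/eq_block.
by rewrite addn1 !add1n.
Qed.

Lemma acyclicP S : reflect (forall s, ~~ is_cycle ends S s) (acyclic ends S).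
Proof. exact: asboolP. Qed.

Lemma acyclic_sub S A : S \subset A -> acyclic ends A -> acyclic ends S.
Proof.
move=> sSA /acyclicP acA; apply/acyclicP => s.
apply: contra (acA s) => /and5P[h1 h2 h3 /allP h4 h5]; apply/and5P; split=> //.
by apply/allP => d /h4; apply: (subsetP sSA).
Qed.

Let step := [rel a b : T * D | ends a.2 == [set a.1; b.1]].

Lemma path_step_connect S a s b :
  path step a (rcons s b) -> {in unzip2 (a :: s), forall d, d \in S} ->
  connect (adj ends S) a.1 b.1.
Proof.
elim: s a => [|a' s IHs] a /=.
  move=> /andP[/eqP ea _] h; apply/connect1/(adj_edge _ ea)/h.
  by rewrite inE.
move=> /andP[/eqP ea pa] h.
have aS : a.2 \in S by apply: h; rewrite inE eqxx.
apply: connect_trans (IHs _ pa _); first exact/connect1/adj_edge/ea.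
by move=> d dS; apply: h; rewrite inE dS orbT.
Qed.

(** Lists a simple path in the format of [is_cycle]. The edges are distinct because the first one
    contains [x], while the later ones have their endpoints in [p]. The last vertex is left out, so
    that a pair [b] carrying a closing edge can be appended. *)
Lemma path_adj_steps S x p : path (adj ends S) x p -> uniq (x :: p) ->
  exists s : seq (T * D),
    [/\ unzip1 s = belast x p, uniq (unzip2 s), {in unzip2 s, forall d, d \in S},
        {in unzip2 s, forall d, {subset ends d <= x :: p}}
      & forall b, b.1 = last x p -> sorted step (rcons s b)].
Proof.
elim: p x => [|y p IHp] x; first by exists [::].
rewrite [path _ _ _]/= => /andP[/adjP[d dS ed] py].
rewrite cons_uniq => /andP[xp up].
have [s [s1 s2 s3 s4 s5]] := IHp y py up; exists ((x, d) :: s); split.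
- by rewrite /= s1.
- rewrite /= s2 andbT; apply: contra xp => /s4; apply.
  by rewrite ed !inE eqxx.
- by move=> d'; rewrite inE => /predU1P[->|/s3].
- move=> d'; rewrite inE => /predU1P[->|/s4 h] z.
    by rewrite ed !inE orbA => ->.
  by move/h; rewrite (in_cons x) => ->; rewrite orbT.
move=> b /[dup] bl /s5; rewrite rcons_cons /=.
have: unzip1 (rcons s b) = y :: p by rewrite /unzip1 map_rcons -/(unzip1 s) s1 bl -lastI.
by case: (rcons s b) => //= a s' [-> _] ->; rewrite ed eqxx.
Qed.

(** A cycle through [d] amounts to a path in [S] between the endpoints of [d]. *)
Lemma acyclicU1 S d x y : d \notin S -> ends d = [set x; y] ->
  acyclic ends (d |: S) = acyclic ends S && ~~ connect (adj ends S) x y.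
Proof.
move=> dS ed; apply/idP/andP => [acU|[acS ncxy]].
  split; first exact: acyclic_sub (subsetUr _ _) acU.
  apply/negP => /connectP[p0 pth0 lst0].
  case/shortenP: pth0 lst0 => p pth up _ lst.
  have [s [s1 s2 s3 s4 s5]] := path_adj_steps pth up.
  (* The pair [(y, d)] closes the simple path from [x] to [y] into a cycle. *)
  have /acyclicP/(_ (rcons s (y, d)))/negP := acU; apply.
  apply/and5P; split.
  - by rewrite -size_eq0 size_rcons.
  - by rewrite /unzip1 map_rcons -/(unzip1 s) s1 /= lst -lastI.
  - by rewrite /unzip2 map_rcons -/(unzip2 s) rcons_uniq s2 andbT; apply: contra dS => /s3.
  - apply/allP => d'; rewrite /unzip2 map_rcons -/(unzip2 s) mem_rcons inE.
    by case/predU1P => [->|/s3 h]; rewrite !inE ?eqxx // h orbT.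
  have := s5 (y, d) lst; rewrite /= -/step.
  have: unzip1 (rcons s (y, d)) = x :: p.
    by rewrite /unzip1 map_rcons -/(unzip1 s) s1 /= lst -lastI.
  rewrite (_ : path.cycle _ _ = path step (y, d) (rcons s (y, d))).
    by case: (rcons s (y, d)) => //= a s' [-> _] ->; rewrite ed setUC eqxx.
  by rewrite /path.cycle; case: (s) => //= a s'; rewrite !rcons_path last_rcons /= andbC.
apply/acyclicP => s; apply/negP => /and5P[sn0 u1 u2 /allP sU cyc].
have [ds|dNs] := boolP (d \in unzip2 s); last first.
  have /acyclicP/(_ s)/negP := acS; apply; apply/and5P; split=> //.
  apply/allP => d' d's; have := sU _ d's; rewrite /= !inE => /predU1P[dd|//].
  by rewrite dd (negPf dNs) in d's.
have [[v d'] vds /= dd] := mapP ds; subst d'.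
(* Rotate the cycle so that [d] comes first; what follows is a path in [S] joining its endpoints. *)
have [i s' defs] := rot_to vds.
have u2' : uniq (unzip2 (rot i s)) by rewrite /unzip2 map_rot rot_uniq.
have cyc' : path.cycle step (rot i s) by rewrite rot_cycle.
have sS : {in unzip2 s', forall d', d' \in S}.
  move=> d' d's'; have: d' \in unzip2 s.
    by rewrite -(mem_rot i) /unzip2 -map_rot defs inE [d' \in _]d's' orbT.
  move/sU; rewrite /= !inE => /predU1P[dd|//].
  by move: u2'; rewrite defs /= -dd [d' \in _]d's'.
move: cyc'; rewrite defs => {defs u2'} cyc'.
case: s' => [|a s'] in sS cyc' *.
  move: cyc'; rewrite /= ed => /andP[/eqP/set2_eq h _].
  by case/negP: ncxy; case: h => -[-> ->]; rewrite connect0.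
move: cyc'; rewrite /= ed => /andP[/eqP/set2_eq h pth].
have := path_step_connect pth sS; rewrite /= => cav.
case/negP: ncxy; case: h => -[-> ->] //.
by rewrite connect_adjC.
Qed.

Lemma acyclic0 : acyclic ends set0.
Proof.
apply/acyclicP => -[//|a s]; apply/negP => /and5P[_ _ _ /allP/(_ a.2)].
by rewrite /= !inE eqxx => /(_ isT).
Qed.

(** Each edge either merges two blocks or closes a cycle, so the bound on [#|T|] is tight exactly
    for forests. From here on acyclicity is handled by counting. *)
Lemma card_forest S : well_formed S ->
  (#|T| <= #|S| + #|blocks S|)%N /\
  acyclic ends S = (#|S| + #|blocks S| == #|T|)%N.
Proof.
have [n] := ubnP #|S|; elim: n S => // n IHn S ltSn wfS.
have [->|/set0Pn[d dS]] := eqVneq S set0.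
  by rewrite cards0 card_blocks0 add0n eqxx acyclic0.
have [x [y ed]] := wfS d dS.
have wfS' : well_formed (S :\ d) by move=> d' /setD1P[_]; apply: wfS.
move: ltSn; rewrite (cardsD1 d) dS add1n => ltSn.
have [le1 ac1] := IHn _ ltSn wfS'.
have := card_blocksU1 (S :\ d) ed; have := acyclicU1 (negbT (setD11 d S)) ed.
rewrite setD1K // => -> cb; rewrite ac1 cb in le1 *.
case: (connect _ x y) le1 => /=; last by rewrite andbT addn1 addnS addSn.
rewrite addn0 andbF addSn => le1; split; first exact: leqW.
by apply/esym/negbTE; rewrite neq_ltn ltnS le1 orbT.
Qed.

Lemma spanning_connectedP S :
  reflect (forall x y, connect (adj ends S) x y) (spanning_connected S).
Proof.
apply: (iffP forallP) => [h x y|h x]; first by have /forallP := h x.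
by apply/forallP => y.
Qed.

Lemma card_blocks_connected S x0 : spanning_connected S -> #|blocks S| = 1%N.
Proof.
move/spanning_connectedP => cS; apply/eqP/cards1P.
exists [set: T]; apply/setP => B; rewrite inE; apply/imsetP/eqP => [[x _ ->]|->].
  by apply/setP => y; rewrite !inE cS.
by exists x0 => //; apply/setP => y; rewrite !inE cS.
Qed.

(** Here [T] may exceed [W], as for quotient graphs, whose vertices lie in the type of all vertex
    sets. Points outside [W] are isolated, so they add as many singleton blocks as vertices and
    cancel in [card_forest]. *)
Lemma spanning_treeE (W : {set T}) S : W != set0 ->
  {in S, forall d, exists x y, [/\ x \in W, y \in W & ends d = [set x; y]]} ->
  spanning_tree ends W S =
  (#|S|.+1 == #|W|) && [forall x in W, forall y in W, connect (adj ends S) x y].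
Proof.
case/set0Pn => w wW wfS; rewrite /spanning_tree; apply: andb_id2r => cW.
have wfS' : well_formed S by move=> d /wfS[x [y [_ _ ->]]]; exists x, y.
have [_ ->] := card_forest wfS'.
have cWP x y : x \in W -> y \in W -> connect (adj ends S) x y.
  by move=> xW yW; have /forall_inP/(_ x xW)/forall_inP/(_ y yW) := cW.
have inW x y : x \in W -> connect (adj ends S) x y -> y \in W.
  move=> xW; apply: (connect_ind (Q := fun y => y \in W)) => // u v uW.
  move=> /adjP[d /wfS[a [b [aW bW ->]]] e].
  by case: (set2_eq e) => -[? ?]; subst u v.
have defB : blocks S = W |: [set [set x] | x in ~: W].
  apply/setP => B; apply/imsetP/setU1P => [[x _ ->]|].
    have [xW|xW] := boolP (x \in W); [left | right].
      apply/setP => y; rewrite inE; apply/idP/idP; first exact: inW.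
      exact: cWP.
    apply/imsetP; exists x; rewrite ?inE //; apply/setP => y; rewrite !inE.
    apply/idP/eqP => [|->]; last exact: connect0.
    case/connectP => -[//|z p] /= /andP[/adjP[d /wfS[a [b [aW bW ->]]] e] _] _.
    by case/negP: xW; case: (set2_eq e) => -[? ?]; subst x z.
  case=> [->|/imsetP[x xW ->]].
    exists w => //; apply/setP => y; rewrite inE.
    by apply/idP/idP; [exact: cWP | exact: inW].
  exists x => //; apply/setP => y; rewrite !inE; apply/eqP/idP => [->|].
    exact: connect0.
  rewrite connect_adjC => cyx; rewrite inE in xW.
  case/connectP: cyx => p; elim/last_ind: p => [//|p z _].
  rewrite rcons_path last_rcons => /andP[_ /adjP[d /wfS[a [b [aW bW ->]]] e]] xz.
  by case/negP: xW; rewrite xz; case: (set2_eq e) => [[_ <-]|[<- _]].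
rewrite defB cardsU1 card_imset; last exact: set1_inj.
suff -> : W \notin [set [set x] | x in ~: W].
  by rewrite addnA -(cardsC W) eqn_add2r addn1.
apply/imsetP => -[x]; rewrite inE => xW WE; case/negP: xW.
by rewrite WE inE.
Qed.

Lemma connected_acyclic S x0 : well_formed S -> spanning_connected S ->
  acyclic ends S = (#|S|.+1 == #|T|).
Proof.
move=> wfS /(card_blocks_connected x0) b1; have [_ ->] := card_forest wfS.
by rewrite b1 addn1.
Qed.

(** A maximal acyclic set between [A] and [S] works: an edge of [S] joining two of its blocks could
    still be added. *)
Lemma extend_to_spanning_tree A S : A \subset S -> acyclic ends A ->
  well_formed S -> spanning_connected S ->
  exists B : {set D},
    [/\ A \subset B, B \subset S, acyclic ends B & spanning_connected B].
Proof.
move=> sAS acA wfS /spanning_connectedP cS.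
have [|B /maxsetP[/andP[sBS acB] maxB] sAB] :=
  @maxset_exists _ (fun B => (B \subset S) && acyclic ends B) A.
  by rewrite sAS.
exists B; split=> //; apply/spanning_connectedP => x y.
have: connect (adj ends S) x y by [].
apply: connect_sub => u v /adjP[d dS ed].
have [dB|dB] := boolP (d \in B); first exact/connect1/adj_edge/ed.
apply: contraNT (dB) => nc; rewrite -(maxB (d |: B)) ?setU11 ?subsetUr //.
by rewrite subUset sub1set dS sBS /= (acyclicU1 dB ed) acB.
Qed.

End Multigraph.

(** * Relabelling and contraction of edges *)

Lemma adj_relabel (T D D' : finType) (ends : D -> {set T})
    (ends' : D' -> {set T}) (h : D -> D') (S : {set D}) :
  {in S, forall d, ends d = ends' (h d)} ->
  adj ends S =2 adj ends' (h @: S).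
Proof.
move=> eh x y; apply/adjP/adjP => [[d dS ed]|[_ /imsetP[d dS ->] ed]].
  by exists (h d); rewrite ?imset_f // -eh.
by exists d; rewrite ?eh.
Qed.

Lemma connect_relabel (T D D' : finType) (ends : D -> {set T})
    (ends' : D' -> {set T}) (h : D -> D') (S : {set D}) :
  {in S, forall d, ends d = ends' (h d)} ->
  connect (adj ends S) =2 connect (adj ends' (h @: S)).
Proof. by move=> eh; apply/eq_connect/adj_relabel. Qed.

(** Relabelling preserves the numbers of edges and of blocks, hence acyclicity by [card_forest]; no
    cycle has to be transported. *)
Lemma acyclic_relabel (T D D' : finType) (ends : D -> {set T})
    (ends' : D' -> {set T}) (h : D -> D') (S : {set D}) :
  injective h -> {in S, forall d, ends d = ends' (h d)} ->
  well_formed ends S -> acyclic ends S = acyclic ends' (h @: S).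
Proof.
move=> h_inj eh wfS.
have wfS' : well_formed ends' (h @: S).
  by move=> _ /imsetP[d dS ->]; rewrite -eh //; apply: wfS.
have [_ ->] := card_forest wfS; have [_ ->] := card_forest wfS'.
rewrite (card_imset _ h_inj); congr (_ + _ == _)%N; congr #|pred_of_set _|.
apply: eq_imset => x; apply/setP => y.
by rewrite !inE (connect_relabel eh).
Qed.

Section Contraction.
Variables (T D : finType) (ends : D -> {set T}).
Variables (T' : finType) (f : T -> T') (C : {set D}).
Hypothesis kerf : forall x y, f x = f y <-> connect (adj ends C) x y.

(** A path in the quotient lifts to [T] once the jumps between points of one fibre of [f] are filled
    by paths in [C]. *)
Lemma connect_contract (S : {set D}) x y : well_formed ends S ->
  connect (adj (fun d => f @: ends d) S) (f x) (f y) =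
  connect (adj ends (C :|: S)) x y.
Proof.
move=> wfS; apply/idP/idP.
  pose Q w := forall z, f z = w -> connect (adj ends (C :|: S)) x z.
  move=> cxy; suff: Q (f y) by exact.
  have fC u v : f u = f v -> connect (adj ends (C :|: S)) u v.
    by move=> /kerf; apply/sub_connect/subsetUl.
  apply: connect_ind cxy => [u v Qu /adjP[d dS]|z /esym]; last exact: fC.
  have [a [b ed]] := wfS d dS; rewrite ed imsetU1 imset_set1 => e z fz.
  have cab : connect (adj ends (C :|: S)) a b.
    by apply/connect1/(adj_edge _ ed); rewrite inE dS orbT.
  case: (set2_eq e) => -[e1 e2].
    by apply: connect_trans (connect_trans (Qu _ e1) cab) (fC _ _ _); rewrite e2.
  rewrite connect_adjC in cab.
  by apply: connect_trans (connect_trans (Qu _ e2) cab) (fC _ _ _); rewrite e1.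
apply: (connect_ind (Q := fun z => is_true (connect _ (f x) (f z)))) => //.
move=> u v cu /adjP[d /setUP[dC|dS] ed].
  by rewrite -(kerf u v).2 //; apply/connect1/adj_edge/ed.
apply: connect_trans cu _; apply/connect1/(adj_edge dS).
by rewrite ed imsetU1 imset_set1.
Qed.

(** Contracting the forest [C] leaves [#|T| - #|C|] vertices, so the edge count for a tree in the
    quotient is the one for a tree containing [C] upstairs. Both kinds of forests behind [Psi] are
    instances: [C] is the set of all star edges, or the forest itself. *)
Lemma contract_spanning_tree (D1 : finType) (ends1 : D1 -> {set T'})
    (h : D1 -> D) (S : {set D1}) (x0 : T) :
  injective h -> {in S, forall d, ends1 d = f @: ends (h d)} ->
  well_formed ends (C :|: h @: S) -> acyclic ends C ->
  spanning_tree ends1 (f @: [set: T]) S =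
  ((#|C| + #|S|).+1 == #|T|) && spanning_connected ends (C :|: h @: S).
Proof.
move=> h_inj eh wfCS acC.
have wfC : well_formed ends C by move=> d dC; apply: wfCS; rewrite inE dC.
have wfS : well_formed ends (h @: S).
  by move=> d dS; apply: wfCS; rewrite inE dS orbT.
have [_] := card_forest wfC; rewrite acC => /esym/eqP cT.
have cfT : #|f @: [set: T]| = #|blocks ends C|.
  pose g x := [set y | connect (adj ends C) x y].
  have gf x y : (f x == f y) = (g x == g y).
    by apply/eqP/eqP => [/kerf/eq_block|/eq_block/kerf].
  (* [pick] chooses a preimage, on which the block does not depend; on the image of [f] the default
     [x0] is never reached. *)
  have -> : blocks ends C = (fun w => g (odflt x0 [pick x | f x == w])) @: (f @: [set: T]).
    rewrite -imset_comp; apply: eq_imset => x /=; apply/eqP.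
    by case: pickP => [z|/(_ x)]; rewrite ?eqxx //= gf eq_sym.
  rewrite [RHS]card_in_imset // => _ _ /imsetP[x _ ->] /imsetP[y _ ->].
  case: pickP => [a /eqP <-|/(_ x)]; last by rewrite eqxx.
  case: pickP => [b /eqP <-|/(_ y)]; last by rewrite eqxx.
  by move/eqP; rewrite -gf => /eqP.
have cE : connect (adj ends1 S) =2 connect (adj (fun d => f @: ends d) (h @: S)).
  exact: connect_relabel.
rewrite spanning_treeE.
- congr (_ && _); first by rewrite cfT -cT -addnS eqn_add2l.
  apply/forall_inP/spanning_connectedP => [cc x y|cc _ /imsetP[x _ ->]].
    have /forall_inP/(_ (f y)) := cc (f x) (imset_f f (in_setT x)).
    rewrite cE (connect_contract _ _ wfS); apply.
    exact: imset_f.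
  apply/forall_inP => _ /imsetP[y _ ->].
  by rewrite cE (connect_contract _ _ wfS).
- by apply/set0Pn; exists (f x0); rewrite imset_f.
- move=> d dS; have [x [y ed]] := wfS _ (imset_f h dS).
  by exists (f x), (f y); rewrite !imset_f // eh // ed imsetU1 imset_set1.
Qed.

End Contraction.

(** * The matrix-tree theorem *)

(* Cauchy-Binet for a weighted sum of rank one matrices: expanding by
   multilinearity, only injective choices of one rank one term per row survive,
   and setting y to an indicator identifies the coefficient of a given T. *)
Lemma det_sum_rank1 (K : comNzRingType) (n : nat) (D : finType)
    (b : D -> 'I_n -> K) (y : D -> K) :
  \det (\matrix_(i < n, j < n) \sum_d y d * (b d i * b d j)) =
  \sum_(T : {set D} | #|T| == n)
    (\prod_(d in T) y d) *
    \det (\matrix_(i < n, j < n) \sum_(d in T) b d i * b d j).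
Proof.
pose gram (z : D -> K) := \matrix_(i < n, j < n) \sum_d z d * (b d i * b d j).
pose a (f : {ffun 'I_n -> D}) :=
  \prod_i b (f i) i * \det (\matrix_(i < n, j < n) b (f i) j).
have expand z : \det (gram z) =
    \sum_(f : {ffun 'I_n -> D} | injectiveb f) (\prod_i z (f i)) * a f.
  transitivity (\sum_(f : {ffun 'I_n -> D}) (\prod_i z (f i)) * a f).
    rewrite /determinant; transitivity
      (\sum_(s : 'S_n) \sum_(f : {ffun 'I_n -> D}) (-1) ^+ s *
         \prod_i (z (f i) * (b (f i) i * b (f i) (s i)))).
      apply: eq_bigr => s _; under eq_bigr do rewrite mxE.
      by rewrite bigA_distr_bigA big_distrr.
    rewrite exchange_big; apply: eq_bigr => f _ /=.
    rewrite /a /determinant mulrA mulr_sumr; apply: eq_bigr => s _.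
    rewrite !big_split /= mulrA mulrCA -!mulrA; congr (_ * (_ * (_ * _))).
    by apply: eq_bigr => i _; rewrite mxE.
  rewrite (bigID (fun f : {ffun 'I_n -> D} => injectiveb f)) /= addrC big1 ?add0r //.
  move=> f /injectivePn[i [j ij fij]].
  rewrite /a (determinant_alternate ij) ?mulr0 // => k.
  by rewrite !mxE fij.
pose A (T : {set D}) :=
  \sum_(f : {ffun 'I_n -> D} | injectiveb f && (f @: [set: 'I_n] == T)) a f.
have group z : \det (gram z) =
    \sum_(T : {set D} | #|T| == n) (\prod_(d in T) z d) * A T.
  rewrite expand (partition_big (fun f : {ffun 'I_n -> D} => f @: [set: 'I_n])
    (fun T : {set D} => #|T| == n)) /=; last first.
    by move=> f /injectiveP f_inj; rewrite card_imset // cardsT card_ord.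
  apply: eq_bigr => T _; rewrite mulr_sumr; apply: eq_bigr => f.
  case/andP=> /injectiveP f_inj /eqP <-; congr (_ * _).
  rewrite big_imset /=; last by move=> i j _ _; apply: f_inj.
  by apply: eq_bigl => i; rewrite inE.
rewrite -/(gram y) group; apply: eq_bigr => T /eqP cT; congr (_ * _).
transitivity (\det (gram (fun d => (d \in T)%:R))).
  rewrite group (bigD1 T) ?cT //= [X in _ + X]big1 ?addr0.
    by rewrite big1 ?mul1r // => d ->.
  move=> T' /andP[/eqP cT' neT].
  have /subsetPn[d dT' dT] : ~~ (T' \subset T).
    by apply: contra neT => sT; rewrite eqEcard sT cT cT' leqnn.
  by rewrite (bigD1 d) //= (negPf dT) !mul0r.
congr (\det _); apply/matrixP => i j; rewrite !mxE [RHS]big_mkcond.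
by apply: eq_bigr => d _; case: (d \in T); rewrite ?mul1r ?mul0r.
Qed.

Section MatrixTree.
Variables (V D : finType) (ends : D -> {set V}) (s t : D -> V) (r : V).
Let n := #|V|.

Definition incidence (d : D) (v : V) : int := (v == t d)%:R - (v == s d)%:R.

(* [None] is a grounding edge at r, which makes the Laplacian nonsingular. *)
Definition ground_incidence (d : option D) (v : V) : int :=
  if d is Some d' then incidence d' v else (v == r)%:R.

(** This is the weighted Laplacian plus the matrix unit at [(r, r)]. Its determinant is the
    Laplacian minor with row and column [r] deleted, but all vertices stay as indices. *)
Definition ground_laplacian (K : comNzRingType) (y : D -> K) : 'M[K]_n :=
  \matrix_(i, j) \sum_(d : option D) oapp y 1 d *
    ((ground_incidence d (enum_val i))%:~R *
     (ground_incidence d (enum_val j))%:~R).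

Lemma sum_ground_incidence (K : comNzRingType) (u : V -> K) (d : option D) :
  \sum_(i < n) u (enum_val i) * (ground_incidence d (enum_val i))%:~R =
  if d is Some d' then u (t d') - u (s d') else u r.
Proof.
have pick v : \sum_x u x * (x == v)%:R = u v.
  rewrite (bigD1 v) //= eqxx mulr1 big1 ?addr0 // => x /negPf ->.
  by rewrite mulr0.
transitivity (\sum_v u v * (ground_incidence d v)%:~R).
  by rewrite [RHS](reindex _ (onW_bij _ (@enum_val_bij V))).
case: d => [d|] /=; last first.
  by rewrite -[RHS]pick; apply: eq_bigr => v _; case: eqP.
rewrite -[u (t d)]pick -[u (s d)]pick -sumrB; apply: eq_bigr => v _.
by rewrite -mulrBr /incidence rmorphB /=; case: eqP; case: eqP.
Qed.

Definition tree_gram (K : comNzRingType) (T : {set option D}) : 'M[K]_n :=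
  \matrix_(i, j) \sum_(d in T) (ground_incidence d (enum_val i))%:~R *
    (ground_incidence d (enum_val j))%:~R.

(** The row vector [u] is orthogonal to every incidence vector in [T], hence lies in the kernel of
    the Gram matrix. *)
Lemma det_tree_gram0 (K : fieldType) (T : {set option D}) (u : V -> K) :
  (exists v, u v != 0) ->
  {in T, forall d, if d is Some d' then u (t d') = u (s d') else u r = 0} ->
  \det (tree_gram K T) = 0.
Proof.
case=> v uv uT; apply/eqP/det0P; exists (\row_i u (enum_val i)).
  apply: contraNneq uv => /rowP/(_ (enum_rank v)).
  by rewrite !mxE enum_rankK => ->.
apply/rowP => j; rewrite !mxE.
under eq_bigr do rewrite !mxE mulr_sumr.
rewrite exchange_big big1 //= => d dT.
under eq_bigr do rewrite mulrA.
rewrite -mulr_suml sum_ground_incidence.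
by have := uT d dT; case: d {dT} => [d|] ->; rewrite ?subrr mul0r.
Qed.

Lemma sum_enum (I : finType) (T : {set I}) (m : nat) : #|T| = m ->
  exists f : 'I_m -> I,
    (forall (K : nmodType) (F : I -> K), \sum_(d in T) F d = \sum_(j < m) F (f j))
    /\ {in T, forall d, exists j, f j = d}.
Proof.
move=> <-; exists enum_val; split=> [K F|d dT]; first exact: big_enum_val.
by exists (enum_rank_in dT d); rewrite enum_rankK_in.
Qed.

(* The incidence matrix B of a connected T has an integral right inverse,
   formed by the paths in T to the root, so its determinant is 1 or -1. *)
Lemma det_tree_gram1 (K : fieldType) (T : {set D}) :
  {in T, forall d, ends d = [set s d; t d]} ->
  #|T|.+1 = n -> spanning_connected ends T ->
  \det (tree_gram K (None |: Some @: T)) = 1.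
Proof.
move=> eT cT /spanning_connectedP connT.
have [|f [fsum fsurj]] := @sum_enum _ (None |: Some @: T) n.
  rewrite cardsU1 card_imset; last by move=> ? ? [].
  by rewrite -cT; case: imsetP => [[]|].
pose B : 'M[int]_n := \matrix_(i, j) ground_incidence (f j) (enum_val i).
pose unit_col v : 'cV[int]_n := \col_i (enum_val i == v)%:R.
have Bcol j : B *m delta_mx j 0 = \col_i ground_incidence (f j) (enum_val i).
  by rewrite -colE; apply/colP => i; rewrite !mxE.
have reach v : exists x : 'cV[int]_n, B *m x = unit_col v.
  apply: (connect_ind (Q := fun v => exists x, B *m x = unit_col v))
    (connT r v) => [u w [x Bx]|]; last first.
    have [|j fj] := fsurj None; first by rewrite !inE.
    by exists (delta_mx j 0); rewrite Bcol fj.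
  move=> /adjP[d dT]; rewrite (eT d dT) => e.
  have [|j fj] := fsurj (Some d); first by rewrite !inE imset_f.
  case: (set2_eq e) => -[e1 e2].
    exists (x + delta_mx j 0); rewrite mulmxDr Bx Bcol fj; apply/colP => i.
    by rewrite !mxE /= /incidence e1 e2 addrC subrK.
  exists (x - delta_mx j 0); rewrite mulmxBr Bx Bcol fj; apply/colP => i.
  by rewrite !mxE /= /incidence e1 e2 opprB addrC subrK.
have [X BX] : exists X, B *m X = 1%:M.
  have [x Bx] := choice reach.
  exists (\matrix_(i, j) x (enum_val j) i 0); apply/matrixP => i j.
  have /colP/(_ i) := Bx (enum_val j); rewrite !mxE (inj_eq enum_val_inj) => <-.
  by apply: eq_bigr => k _; rewrite !mxE.
have detB : \det B ^+ 2 = 1.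
  have /(congr1 absz) : \det B * \det X = 1 by rewrite -det_mulmx BX det1.
  rewrite abszM => /eqP; rewrite muln_eq1 => /andP[/eqP B1 _].
  by rewrite -real_normK ?num_real // -abszE B1.
transitivity (\det (map_mx intr (B *m B^T)) : K).
  congr (\det _); apply/matrixP => i j; rewrite !mxE fsum rmorph_sum.
  by apply: eq_bigr => k _; rewrite !mxE rmorphM.
by rewrite det_map_mx det_mulmx det_tr -expr2 detB rmorph1.
Qed.

Theorem matrix_tree (K : fieldType) (y : D -> K) :
  (forall d, y d != 0 -> ends d = [set s d; t d]) ->
  \det (ground_laplacian y) =
  \sum_(T : {set D} | (#|T|.+1 == n) && spanning_connected ends T)
     \prod_(d in T) y d.
Proof.
move=> ye; rewrite /ground_laplacian.
rewrite (det_sum_rank1 (fun d (i : 'I_n) => (ground_incidence d (enum_val i))%:~R)).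
under eq_bigr => T _ do rewrite -/(tree_gram K T).
rewrite (bigID (fun T : {set option D} => None \in T)) /= [X in _ + X]big1 ?addr0.
  rewrite (reindex_onto (fun T : {set D} => None |: Some @: T)
                        (fun T => Some @^-1: T)) /=; last first.
    move=> T /andP[_ NT]; apply/setP => -[d|]; rewrite !inE ?NT //=.
    by rewrite mem_imset ?inE // => ? ? [].
  have someK (T : {set D}) : Some @^-1: (None |: Some @: T) = T.
    by apply/setP => d; rewrite !inE mem_imset // => ? ? [].
  have NS (T : {set D}) : None \notin Some @: T by case: imsetP => [[]|].
  transitivity (\sum_(T : {set D} | #|T|.+1 == n)
      (\prod_(d in T) y d) * \det (tree_gram K (None |: Some @: T))).
    apply: eq_big => T.
      rewrite someK eqxx setU11 !andbT cardsU1 NS card_imset //.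
      by move=> ? ? [].
    move=> _; rewrite big_setU1 //= mul1r big_imset //.
    by move=> ? ? _ _ [].
  rewrite [RHS]big_mkcondr; apply: eq_bigr => T /eqP cT.
  have [/forall_inP yT|] := boolP [forall d in T, y d != 0]; last first.
    case/forall_inPn => d dT; rewrite negbK => /eqP yd.
    by rewrite (bigD1 d) //= yd !mul0r; case: ifP.
  have eT : {in T, forall d, ends d = [set s d; t d]} by move=> d /yT/ye.
  case: ifPn => [cnT|ncT]; first by rewrite det_tree_gram1 ?mulr1.
  (* The indicator of the vertices not reachable from [r] vanishes at [r] and is constant along the
     edges of [T]. *)
  rewrite (@det_tree_gram0 _ _ (fun v => (~~ connect (adj ends T) r v)%:R)) ?mulr0 //.
    have [/existsP[v nc]|] := boolP [exists v, ~~ connect (adj ends T) r v].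
      by exists v; rewrite nc oner_neq0.
    rewrite negb_exists => /forallP rc; case/negP: ncT.
    apply/spanning_connectedP => u v.
    have := rc u; have := rc v; rewrite !negbK => rv ru.
    by rewrite connect_adjC in ru; apply: connect_trans ru rv.
  move=> [d|] /=; last by rewrite connect0.
  rewrite !inE mem_imset /= => [dT|? ? []//].
  have c := connect1 (adj_edge dT (eT d dT)).
  by rewrite (same_connect_r (@connect_adjC _ _ _ _) c).
move=> T /andP[cT NT].
(* Without the grounding edge the constant vectors lie in the kernel. *)
rewrite (@det_tree_gram0 _ _ (fun=> 1)) ?mulr0 //.
  by exists r; rewrite oner_neq0.
by case=> // /(negP NT).
Qed.

End MatrixTree.

(** * Stability and the Rayleigh inequality *)

Section ComplexParts.
Variable R : rcfType.

Lemma Re_sum (I : finType) (F : I -> R[i]) :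
  complex.Re (\sum_i F i) = \sum_i complex.Re (F i).
Proof. by apply: (big_morph (@complex.Re R)) => // -[? ?] []. Qed.

Lemma Im_sum (I : finType) (F : I -> R[i]) :
  complex.Im (\sum_i F i) = \sum_i complex.Im (F i).
Proof. by apply: (big_morph (@complex.Im R)) => // -[? ?] []. Qed.

Lemma Re_mulr (z : R[i]) (a : R) : complex.Re (z * a%:C%C) = complex.Re z * a.
Proof. by case: z => x y /=; rewrite mulr0 subr0. Qed.

Lemma Im_mulr (z : R[i]) (a : R) : complex.Im (z * a%:C%C) = complex.Im z * a.
Proof. by case: z => x y /=; rewrite mulr0 add0r. Qed.

(* A vector in the kernel of the Laplacian annihilates the quadratic form
   sum of y_d |u(t d) - u(s d)|^2, grounded at r; its imaginary part, then its
   real part, force u to be constant along every edge with y_d != 0. *)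
Lemma ground_laplacian_nonsingular (V D : finType) (ends : D -> {set V})
    (s t : D -> V) (r : V) (y : D -> R[i]) (S : {set D}) :
  {in S, forall d, ends d = [set s d; t d]} -> spanning_connected ends S ->
  {in S, forall d, y d != 0} ->
  (forall d, complex.Im (y d) <= 0) ->
  (forall d, complex.Im (y d) = 0 -> 0 <= complex.Re (y d)) ->
  \det (ground_laplacian s t r y) != 0.
Proof.
move=> eS /spanning_connectedP cS yS imy rey; apply/det0P => -[v v0 vL].
pose u x := v 0 (enum_rank x).
pose l (d : option D) := if d is Some d' then u (t d') - u (s d') else u r.
have lE d : l d = \sum_i v 0 i * (ground_incidence s t r d (enum_val i))%:~R.
  rewrite /l -(sum_ground_incidence s t r u); apply: eq_bigr => i _.
  by rewrite /u enum_valK.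
pose q d := complex.Re (l d) ^+ 2 + complex.Im (l d) ^+ 2.
have q_ge0 d : 0 <= q d by rewrite addr_ge0 ?sqr_ge0.
pose y' d := oapp y 1 d.
have form0 : \sum_d y' d * (q d)%:C%C = 0.
  transitivity (\sum_j (v *m ground_laplacian s t r y) 0 j * conjc (v 0 j)).
    under [RHS]eq_bigr do rewrite mxE mulr_suml.
    rewrite exchange_big /=.
    under [RHS]eq_bigr do under eq_bigr do rewrite mxE mulr_sumr mulr_suml.
    under [RHS]eq_bigr do rewrite exchange_big.
    rewrite exchange_big /=; apply: eq_bigr => d _.
    rewrite add_Re2_Im2 sqr_normc {1}lE lE rmorph_sum mulr_suml mulr_sumr.
    apply: eq_bigr => i _; rewrite !mulr_sumr; apply: eq_bigr => j _.
    rewrite rmorphM /= rmorph_int -/(y' d); ring.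
  by rewrite vL big1 // => j _; rewrite mxE mul0r.
have imy' d : complex.Im (y' d) <= 0 by case: d => [d|] /=.
have im0 d : complex.Im (y' d) * q d = 0.
  have /(congr1 (@complex.Im R)) := form0; rewrite Im_sum => /eqP.
  under eq_bigr do rewrite Im_mulr.
  rewrite -oppr_eq0 -sumrN psumr_eq0 => [/allP/(_ d (mem_index_enum d))|d' _].
    by rewrite oppr_eq0 => /eqP.
  by rewrite oppr_ge0 mulr_le0_ge0.
(* Where [q d] is nonzero, [im0] makes the weight real, hence nonnegative; again a vanishing sum has
   terms of one sign. *)
have re0 d : complex.Re (y' d) * q d = 0.
  have /(congr1 (@complex.Re R)) := form0; rewrite Re_sum => /eqP.
  under eq_bigr do rewrite Re_mulr.
  rewrite psumr_eq0 => [/allP/(_ d (mem_index_enum d))/eqP //|d' _].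
  have /eqP := im0 d'; rewrite mulf_eq0 => /orP[/eqP i0|/eqP ->].
    apply: mulr_ge0 => //; case: d' i0 => [d'|] //=; first exact: rey.
  by rewrite mulr0.
have l0 d : y' d != 0 -> l d = 0.
  have [q0 _|q0] := eqVneq (q d) 0.
    by apply/eqP; rewrite -sqrf_eq0 -normr_eq0 normrX -add_Re2_Im2 -/(q d) q0.
  case/negP; rewrite eq_complex.
  have /eqP := im0 d; rewrite mulf_eq0 (negPf q0) orbF => ->.
  by have /eqP := re0 d; rewrite mulf_eq0 (negPf q0) orbF => ->.
case/negP: v0; apply/eqP/rowP => i; rewrite mxE -(enum_valK i) -/(u _).
apply: (connect_ind (Q := fun x => u x = 0)) (cS r (enum_val i)) => [x z ux|].
  move=> /adjP[d dS]; rewrite (eS d dS) => e.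
  have /eqP := l0 (Some d) (yS d dS); rewrite subr_eq0 => /eqP.
  by case: (set2_eq e) => -[-> ->]; rewrite ux.
by apply: (l0 None); rewrite oner_neq0.
Qed.

End ComplexParts.

(** For real coefficients, [x + i y] is the root of [(a - i b) + (c - i d) z]; the two equations are
    its real and imaginary parts. *)
Lemma bilinear_root (K : fieldType) (a b c d : K) : c ^+ 2 + d ^+ 2 != 0 ->
  let x := - (a * c + b * d) / (c ^+ 2 + d ^+ 2) in
  let y := (b * c - a * d) / (c ^+ 2 + d ^+ 2) in
  a + x * c + y * d = 0 /\ y * c - (b + x * d) = 0.
Proof. by move=> q_neq0 x y; rewrite /x /y; split; field. Qed.

(** * Multiaffine generating polynomials *)

Section GeneratingPolynomial.
Variables (V : finType).
Implicit Types (N S T I : {set V}).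

Lemma gen_polyU1 (K : comNzRingType) N (i : V) (a : {set V} -> K) (z : V -> K) :
  i \notin N ->
  gen_poly (i |: N) a z =
  gen_poly N a z + z i * gen_poly N (fun S => a (i |: S)) z.
Proof.
move=> iN; rewrite {1}/gen_poly (bigID (fun I => i \notin I)) /=; congr (_ + _).
  by apply: eq_bigl => I; rewrite -subsetD1 setU1K.
rewrite /gen_poly big_distrr /=.
rewrite (reindex_onto (fun S => i |: S) (fun I => I :\ i)) /=; last first.
  by move=> I /andP[_]; rewrite negbK => /setD1K.
apply: eq_big => [S|S /andP[_ /eqP SK]].
  rewrite setU11 andbT subUset sub1set setU11 /=.
  apply/andP/idP => [[sSN /eqP SK]|sSN].
    by rewrite -(setU1K iN) subsetD1 sSN -SK setD11.
  have iS : i \notin S by apply: contra iN => /(subsetP sSN).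
  by rewrite setU1K // (subset_trans sSN) // subsetUr.
have iS : i \notin S by rewrite -SK setD11.
by rewrite big_setU1 //= mulrCA.
Qed.

Lemma eq_gen_poly (K : comNzRingType) N (a : {set V} -> K) (z w : V -> K) :
  {in N, z =1 w} -> gen_poly N a z = gen_poly N a w.
Proof.
move=> zw; apply: eq_bigr => I sIN; congr (_ * _); apply: eq_bigr => i iI.
by rewrite zw ?(subsetP sIN).
Qed.

Lemma gen_poly_restrict (K : comNzRingType) N S (a : {set V} -> K) (z : V -> K) :
  S \subset N -> {in N :\: S, forall i, z i = 0} ->
  gen_poly N a z = gen_poly S a z.
Proof.
move=> sSN z0; rewrite /gen_poly (bigID (fun I => I \subset S)) /=.
rewrite [X in _ + X]big1 ?addr0 => [|I /andP[sIN /subsetPn[i iI iS]]].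
  by apply: eq_bigl => I; apply: andb_idl => /subset_trans; apply.
rewrite (bigD1 i) //= z0 ?mul0r ?mulr0 //.
by rewrite inE iS (subsetP sIN).
Qed.

Lemma rmorph_gen_poly (K L : comNzRingType) (h : {rmorphism K -> L}) N
    (a : {set V} -> K) (z : V -> K) :
  gen_poly N (h \o a) (h \o z) = h (gen_poly N a z).
Proof.
rewrite /gen_poly rmorph_sum; apply: eq_bigr => I _.
by rewrite rmorphM rmorph_prod.
Qed.

(* Univariate in the inverse of the common value of the variables, so that
   letting this value tend to infinity becomes evaluation at 0. *)
Definition reversal (K : comNzRingType) S (a : {set V} -> K) : {poly K} :=
  \sum_(T : {set V} | T \subset S) a T *: 'X^#|S :\: T|.

Lemma reversal0 (K : comNzRingType) S (a : {set V} -> K) :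
  (reversal S a).[0] = a S.
Proof.
rewrite horner_sum (bigD1 S) //= setDv cards0 hornerZ hornerXn mulr1.
rewrite big1 ?addr0 // => T /andP[sTS neTS]; rewrite hornerZ hornerXn.
rewrite expr0n -[_ == _]negbK cards_eq0 setD_eq0.
suff -> : S \subset T = false by rewrite mulr0.
by apply: contraNF neTS => sST; rewrite eqEsubset sTS.
Qed.

Lemma horner_reversal (K : fieldType) S (a : {set V} -> K) (e : K) : e != 0 ->
  (reversal S a).[e] = e ^+ #|S| * gen_poly S a (fun=> e^-1).
Proof.
move=> e0; rewrite horner_sum /gen_poly big_distrr /=; apply: eq_bigr => T sTS.
rewrite hornerZ hornerXn prodr_const mulrCA; congr (_ * _).
by rewrite cardsD (setIidPr sTS) exprVn expfB_cond // (negPf e0) subset_leq_card.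
Qed.

Lemma horner0_ge0 (R : rcfType) (p : {poly R}) :
  (forall e, 0 < e -> 0 <= p.[e]) -> 0 <= p.[0].
Proof.
move=> p_ge0; rewrite leNgt; apply/negP => p0.
have [|d d0 /(_ (d / 2))] := @poly_cont _ 0 p (- p.[0]); first by rewrite oppr_gt0.
have d20 : 0 < d / 2 by rewrite divr_gt0.
rewrite subr0 gtr0_norm // ltr_pdivrMr // ltr_pMr // ltr1n => /(_ isT).
rewrite ltr_norml opprK => /andP[_]; rewrite ltrBlDr addNr => h.
by have := p_ge0 _ d20; rewrite leNgt h.
Qed.

(** * From stability to log-submodularity *)

Section Rayleigh.
Variables (R : rcfType) (N : {set V}) (f : {set V} -> R).
Hypothesis f_gt0 : forall S, S \subset N -> 0 < f S.
(** Nonvanishing on the open lower half-plane together with the nonnegative reals; the values 0 and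
    [e > 0] can thus be substituted directly, without a limiting argument on zeros. *)
Hypothesis f_neq0 : forall w : V -> R[i],
  {in N, forall i, complex.Im (w i) <= 0} ->
  {in N, forall i, complex.Im (w i) = 0 -> 0 <= complex.Re (w i)} ->
  gen_poly N (fun S => (f S)%:C%C) w != 0.

(* If a polynomial a + b y + c x + d x y with nonnegative coefficients had
   b c < a d, then at x = -i it would vanish at some y in the lower half-plane. *)
Lemma rayleigh_specialized S i j (e : R) : 0 < e ->
  i \in N -> j \in N -> S \subset N -> i != j -> i \notin S -> j \notin S ->
  gen_poly S f (fun=> e) * gen_poly S (fun T => f (i |: (j |: T))) (fun=> e) <=
  gen_poly S (fun T => f (i |: T)) (fun=> e) *
    gen_poly S (fun T => f (j |: T)) (fun=> e).
Proof.
move=> e0 iN jN sSN ij iS jS.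
set a := gen_poly S f _; set d := gen_poly S _ _.
set b := gen_poly S _ _; set c := gen_poly S _ _.
have gp_ge0 (A : {set V}) : A \subset N -> 0 <= gen_poly S (fun T => f (A :|: T)) (fun=> e).
  move=> sAN; apply: sumr_ge0 => T sTS; rewrite mulr_ge0 //.
    by rewrite ltW // f_gt0 // subUset sAN (subset_trans sTS).
  by apply: prodr_ge0 => ? _; apply: ltW.
have b0 : 0 <= b by apply: gp_ge0; rewrite sub1set.
have c0 : 0 <= c by apply: gp_ge0; rewrite sub1set.
have d0 : 0 <= d.
  have := gp_ge0 [set i; j]; rewrite subUset !sub1set iN jN => /(_ isT).
  by congr (_ <= _); apply: eq_bigr => T _; rewrite setUA.
rewrite leNgt; apply/negP => lt_bc.
have d_neq0 : d != 0.
  by apply: contraTneq lt_bc => ->; rewrite mulr0 -leNgt mulr_ge0.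
pose q := c ^+ 2 + d ^+ 2.
have q0 : 0 < q by rewrite ltr_wpDl ?sqr_ge0 // exprn_even_gt0.
pose zj : R[i] := ((- (a * c + b * d) / q) +i* ((b * c - a * d) / q))%C.
pose zi : R[i] := (0 -i* 1)%C.
(* With [i] set to minus the imaginary unit, [zj] is the root of the remaining linear polynomial.
   The value 0 removes the variables outside [S], [i] and [j]. *)
pose w x := if x == i then zi else if x == j then zj else
            if x \in S then e%:C%C else 0.
have ziN : complex.Im zi < 0 by rewrite /= oppr_lt0 ltr01.
have zjN : complex.Im zj < 0 by rewrite /= pmulr_llt0 ?invr_gt0 // subr_lt0.
have /negP[] : gen_poly N (fun T => (f T)%:C%C) w != 0.
  apply: f_neq0 => x _; rewrite /w.
    case: ifP => _; first exact: ltW.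
    case: ifP => _; first exact: ltW.
    by case: ifP.
  case: ifP => _; first by move=> zi0; rewrite zi0 ltxx in ziN.
  case: ifP => _; first by move=> zj0; rewrite zj0 ltxx in zjN.
  by case: ifP => _ _ //=; apply: ltW.
have sU : i |: (j |: S) \subset N by rewrite !subUset !sub1set iN jN.
rewrite (gen_poly_restrict _ sU); last first.
  move=> x; rewrite !inE !negb_or => /andP[/and3P[xi xj xS] _].
  by rewrite /w (negPf xi) (negPf xj) (negPf xS).
have jNi : i \notin j |: S by rewrite !inE negb_or ij.
rewrite gen_polyU1 // !gen_polyU1 //.
have gpC (g : {set V} -> R) :
    gen_poly S (fun T => (g T)%:C%C) w = (gen_poly S g (fun=> e))%:C%C.
  rewrite -(rmorph_gen_poly (real_complex R)); apply: eq_gen_poly => x xS /=.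
  rewrite /w xS; case: eqP => [xi|_]; first by rewrite -xi xS in iS.
  by case: eqP => [xj|//]; rewrite -xj xS in jS.
rewrite (gpC f) (gpC (fun T => f (j |: T))) (gpC (fun T => f (i |: T))).
rewrite (gpC (fun T => f (i |: (j |: T)))) -/a -/b -/c -/d.
rewrite /w !eqxx [j == i]eq_sym (negPf ij).
have [reE imE] := @bilinear_root _ a b c d (lt0r_neq0 q0).
rewrite eq_complex /=; apply/andP; split; apply/eqP.
  rewrite !(mulr0, mul0r, subr0, addr0, add0r, sub0r, mulN1r, opprK).
  exact: reE.
rewrite !(mulr0, mul0r, subr0, addr0, add0r, sub0r, mulN1r, opprK).
exact: imE.
Qed.

(** Give all variables of [S] the value [1/e] and clear denominators: the difference of the two
    sides is a polynomial in [e], nonnegative for [e > 0]. At [e = 0] only the coefficients of the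
    full monomial in [S] survive. *)
Lemma rayleigh S i j : i \in N -> j \in N -> S \subset N -> i != j ->
  i \notin S -> j \notin S ->
  f S * f (i |: (j |: S)) <= f (i |: S) * f (j |: S).
Proof.
move=> iN jN sSN ij iS jS; rewrite -subr_ge0.
have := @horner0_ge0 R (reversal S (fun T => f (i |: T)) *
    reversal S (fun T => f (j |: T)) -
    reversal S f * reversal S (fun T => f (i |: (j |: T)))).
rewrite hornerD hornerN !hornerM !reversal0; apply => e e0.
have e_neq0 : e != 0 by rewrite gt_eqF.
rewrite hornerD hornerN !hornerM !horner_reversal //.
rewrite [X in X - _]mulrACA [X in _ - X]mulrACA -mulrBr mulr_ge0 //.
  by rewrite mulr_ge0 // exprn_ge0 // ltW.
by rewrite subr_ge0 rayleigh_specialized // invr_gt0.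
Qed.

(** The ratio [f (j |: S) / f S] decreases as [S] grows: [rayleigh] says so for one added element,
    and such steps are chained from [S] to [T]. *)
Lemma increment_decreasing S T j : S \subset T -> T \subset N ->
  j \in N -> j \notin T -> f (j |: T) * f S <= f (j |: S) * f T.
Proof.
have [n] := ubnP #|T :\: S|; elim: n T => // n IHn T leTn sST sTN jN jT.
have [/eqP|/set0Pn[k /setDP[kT kS]]] := eqVneq (T :\: S) set0.
  rewrite setD_eq0 => sTS; suff -> : T = S by [].
  by apply/eqP; rewrite eqEsubset sTS.
have sST' : S \subset T :\ k by rewrite subsetD1 sST.
have sT'N : T :\ k \subset N by rewrite (subset_trans (subD1set _ _)).
have jT' : j \notin T :\ k by rewrite !inE negb_and jT orbT.
have := IHn (T :\ k); rewrite sST' sT'N jN jT'.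
have -> : (#|(T :\ k) :\: S| < n)%N.
  move: leTn; rewrite (cardsD1 k) !inE kT kS add1n ltnS.
  by rewrite setDDl setUC -setDDl.
move=> /(_ isT isT isT isT isT) h1.
have jk : j != k by apply: contraNneq jT => ->.
have := @rayleigh (T :\ k) j k jN (subsetP sTN _ kT) sT'N jk jT'.
rewrite setD11 setD1K // => /(_ isT) h2.
have p1 : 0 < f (T :\ k) by apply: f_gt0.
have p2 : 0 < f (j |: T :\ k) by rewrite f_gt0 // subUset sub1set jN.
(* The product of [h1] and [h2] is the goal times this common factor, which may be cancelled because
   [f] is strictly positive. *)
rewrite -(ler_pM2l (mulr_gt0 p1 p2)).
have hS : 0 < f S by rewrite f_gt0 // (subset_trans sST).
have hT : 0 < f T by rewrite f_gt0.
have h3 := ler_pM (mulr_ge0 (ltW p1) _) (mulr_ge0 (ltW p2) (ltW hS)) h2 h1.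
have {}h3 := h3 (ltW (f_gt0 _)); rewrite subUset sub1set jN sTN in h3.
have {}h3 := h3 isT.
by apply: le_trans (le_trans _ h3) _;
  rewrite le_eqVlt; apply/orP; left; apply/eqP; ring.
Qed.

(** Remove some [k] of [S] outside [T]: the factor gained by adding it back is no larger at
    [S :\ k :|: T] than at [S :\ k]. *)
Lemma log_submodular S T : S \subset N -> T \subset N ->
  f (S :|: T) * f (S :&: T) <= f S * f T.
Proof.
have [n] := ubnP #|S :\: T|; elim: n S => // n IHn S leSn sSN sTN.
have [/eqP|/set0Pn[k /setDP[kS kT]]] := eqVneq (S :\: T) set0.
  by rewrite setD_eq0 => sST; rewrite (setUidPr sST) (setIidPl sST) mulrC.
have sS'N : S :\ k \subset N by rewrite (subset_trans (subD1set _ _)).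
have sUN : S :\ k :|: T \subset N by rewrite subUset sS'N.
have := IHn (S :\ k); rewrite sS'N sTN.
have -> : (#|(S :\ k) :\: T| < n)%N.
  move: leSn; rewrite (cardsD1 k) !inE kT kS add1n ltnS.
  by rewrite setDDl setUC -setDDl.
have -> : (S :\ k) :&: T = S :&: T.
  apply/setP => x; rewrite !inE; case: eqP => // ->.
  by rewrite (negPf kT) !andbF.
move=> /(_ isT isT isT) h1.
have := @increment_decreasing (S :\ k) (S :\ k :|: T) k (subsetUl _ _) sUN
  (subsetP sSN _ kS).
rewrite !inE eqxx (negPf kT) setUA setD1K // => /(_ isT) h2.
have p1 : 0 < f (S :\ k) by apply: f_gt0.
have p2 : 0 < f (S :\ k :|: T) by apply: f_gt0.
rewrite -(ler_pM2l (mulr_gt0 p1 p2)).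
have h : 0 < f (S :|: T) by rewrite f_gt0 // subUset sSN.
have h' : 0 < f (S :&: T) by rewrite f_gt0 // (subset_trans (subsetIl _ _)).
have h3 := ler_pM (mulr_ge0 (ltW h) (ltW p1)) (mulr_ge0 (ltW p2) (ltW h')) h2 h1.
by apply: le_trans (le_trans _ h3) _;
  rewrite le_eqVlt; apply/orP; left; apply/eqP; ring.
Qed.

End Rayleigh.

End GeneratingPolynomial.

(** * Networks with superports *)

Section PortNetwork.
Variables (R : realType) (V : finType) (E : {set {set V}}) (c : {set V} -> R).
Variables (M : {set V}) (P : {set {set V}}) (rt : {set V} -> V).
Hypotheses (simpleE : simple_graph E) (connE : connected_graph E).
Hypothesis c_gt0 : {in E, forall e, 0 < c e}.
Hypotheses (M_neq0 : M != set0) (partP : partition P M).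
Hypothesis rtP : {in P, forall A, rt A \in A}.

Implicit Types (F : {set {set V}}) (I S : {set V}).

Let N := nonroots M P rt.
Let root := root_of P rt.

(* The network with one extra edge from each x in N to the root of its
   superport: a valid forest or a forest with a port tree is exactly the trace
   on E of a spanning tree of this graph. *)
Definition star_ends (d : {set V} + V) : {set V} :=
  match d with inl e => e | inr x => [set root x; x] end.

Definition star_union (F : {set {set V}}) (S : {set V}) : {set {set V} + V} :=
  inl @: F :|: inr @: S.

(** The sum runs over the spanning trees of the enlarged graph whose added edges are exactly [S],
    encoded as connected sets of [#|V| - 1] edges to match [matrix_tree]. Only the edges of [E] are
    weighted. *)
Definition tree_sum (S : {set V}) : R :=
  \sum_(F : {set {set V}} | [&& F \subset E, (#|F| + #|S|).+1 == #|V|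
              & spanning_connected star_ends (star_union F S)]) weight c F.

Lemma inl_union F S e : (inl e \in star_union F S) = (e \in F).
Proof.
rewrite inE mem_imset; last by move=> ? ? [].
by rewrite orbC; case: imsetP => [[]|].
Qed.

Lemma inr_union F S x : (inr x \in star_union F S) = (x \in S).
Proof.
by rewrite inE orbC mem_imset => [|? ? []//]; case: imsetP => [[]|]; rewrite ?orbF.
Qed.

Lemma card_union F S : #|star_union F S| = (#|F| + #|S|)%N.
Proof.
rewrite cardsU !card_imset; try by move=> ? ? [].
rewrite (_ : _ :&: _ = set0) ?cards0 ?subn0 //; apply/setP => d; rewrite !inE.
by apply/andP => -[/imsetP[e _ ->] /imsetP[]].
Qed.

Lemma wf_union F S : F \subset E -> well_formed star_ends (star_union F S).
Proof.
move=> FE [e|x]; last by exists (root x), x.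
rewrite inl_union => eF.
have /eqP/cards2P[x [y [_ ->]]] := simpleE (subsetP FE _ eF).
by exists x, y.
Qed.

Lemma nonrootP x : x \in N ->
  [/\ x \in M, pblock P x \in P, root x \in pblock P x & root x != x].
Proof.
case/setDP => xM xr; have xc : x \in cover P by rewrite (cover_partition partP).
have xP := pblock_mem xc; split=> //; first exact: rtP.
by apply: contraNneq xr => <-; apply: imset_f.
Qed.

(** The added edges form one star per superport, centred at its root, so contracting them identifies
    precisely the vertices of each superport. *)
Lemma quot_kernel x y :
  quot M P x = quot M P y <->
  connect (adj star_ends (star_union set0 N)) x y.
Proof.
have [/eqP covP trivP _] := and3P partP; split.
  have to_root z : z \in M -> connect (adj star_ends (star_union set0 N)) z (root z).
    move=> zM; have [zN|] := boolP (z \in N).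
      apply/connect1; apply: (@adj_edge _ _ _ _ (inr z)); first by rewrite inr_union.
      by rewrite /= setUC.
    rewrite inE zM andbT negbK => /imsetP[A AP zA].
    have -> : root z = z; last exact: connect0.
    rewrite [in LHS]zA /root /root_of (def_pblock trivP AP) //; exact: rtP.
  rewrite /quot; case: ifP => xM; case: ifP => yM.
  - move=> eP; apply: connect_trans (to_root x xM) _.
    by rewrite connect_adjC /root /root_of eP; apply: to_root.
  - move=> eP; have: x \in pblock P x by rewrite mem_pblock covP.
    by rewrite eP inE => /eqP xy; rewrite -xy xM in yM.
  - move=> eP; have: y \in pblock P y by rewrite mem_pblock covP.
    by rewrite -eP inE => /eqP xy; rewrite -xy yM in xM.
  by move/set1_inj ->; apply: connect0.
apply: (connect_ind (Q := fun y => quot M P x = quot M P y)) => // u v -> /adjP[d].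
case: d => [e|z]; first by rewrite inl_union inE.
rewrite inr_union => /nonrootP[zM zP rz _] /= e.
have rM : root z \in M by rewrite -covP; apply/bigcupP; exists (pblock P z).
have qz : quot M P (root z) = quot M P z.
  by rewrite /quot rM zM (def_pblock trivP zP rz).
by case: (set2_eq e) => -[<- <-].
Qed.

(** The nonroot end [x] of an added edge meets no other added edge, since the other ends are roots
    or different nonroots; every edge is thus pendant. *)
Lemma stars_acyclic S : S \subset N -> acyclic star_ends (star_union set0 S).
Proof.
have [n] := ubnP #|S|; elim: n S => // n IHn S ltSn sSN.
have [->|/set0Pn[x xS]] := eqVneq S set0.
  by rewrite /star_union !imset0 setU0 acyclic0.
have -> : star_union set0 S = inr x |: star_union set0 (S :\ x).
  by rewrite /star_union !imset0 !set0U -imsetU1 setD1K.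
have xN := subsetP sSN x xS; have [_ _ _ rx] := nonrootP xN.
rewrite (acyclicU1 (x := root x) (y := x)) ?inr_union ?setD11 //.
rewrite IHn ?(subset_trans (subsetDl _ _)) //; last first.
  by move: ltSn; rewrite (cardsD1 x) xS.
apply/negP; rewrite connect_adjC => /connectP[[|y p]] /=.
  by move=> _ xr; rewrite xr eqxx in rx.
move=> /andP[/adjP[[e|z]]]; first by rewrite inl_union inE.
rewrite inr_union => /setD1P[zx zS] /= e _ _.
have zN := subsetP sSN z zS; have [_ zP _ _] := nonrootP zN.
case: (set2_eq e) => [[h _]|[_ h]]; last by rewrite h eqxx in zx.
have /setDP[_ /negP[]] := xN; rewrite -h; exact: imset_f.
Qed.

Lemma component_kernel F x y :
  component F x = component F y <->
  connect (adj star_ends (star_union F set0)) x y.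
Proof.
rewrite /star_union imset0 setU0 -(@connect_relabel _ _ _ id _ _ F _) //.
exact: eq_block.
Qed.

(** For empty [I], contract all the stars and keep [F]; otherwise contract [F] and keep the port
    edges. Both yield the spanning trees of one enlarged graph, which unifies the two cases of
    [Psi]. *)
Lemma Psi_tree_sum I : I \subset N -> Psi E c M P rt I = tree_sum (N :\: I).
Proof.
move=> sIN; have [x0 _] := set0Pn _ M_neq0.
have inl_inj : injective (@inl {set V} V) by move=> ? ? [].
have inr_inj : injective (@inr {set V} V) by move=> ? ? [].
have union0F F : inl @: F = star_union F set0 by rewrite /star_union imset0 setU0.
have union0S S : inr @: S = star_union set0 S by rewrite /star_union imset0 set0U.
have acE F : F \subset E ->
    acyclic id F = acyclic star_ends (star_union F set0).
  move=> FE; rewrite -union0F; apply: acyclic_relabel => // e eF.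
  have /eqP/cards2P[x [y [_ ->]]] := simpleE (subsetP FE _ eF).
  by exists x, y.
have acF F S : F \subset E ->
    spanning_connected star_ends (star_union F S) ->
    (#|F| + #|S|).+1 == #|V| -> acyclic id F.
  move=> FE cFS cF; rewrite acE //.
  apply: (@acyclic_sub _ _ _ _ (star_union F S)).
    by rewrite -union0F subsetUl.
  by rewrite (connected_acyclic x0) ?card_union //; apply: wf_union.
rewrite /Psi; case: eqVneq => [->|I0]; apply: eq_bigl => F.
  rewrite setD0 /valid /spanning_forest -andbA; apply: andb_id2l => FE.
  have uFN : star_union set0 N :|: inl @: F = star_union F N.
    by rewrite -union0S setUC.
  rewrite (@contract_spanning_tree _ _ star_ends _ _ _ quot_kernel _ _ inl _ x0) //.
  - rewrite uFN card_union cards0 add0n addnC.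
    apply: andb_idl => /andP[cF cFN]. exact: acF FE cFN cF.
  - by rewrite uFN; apply: wf_union.
  - exact: stars_acyclic.
rewrite /spanning_forest -andbA; apply: andb_id2l => FE.
have uFS : star_union F set0 :|: inr @: (N :\: I) = star_union F (N :\: I).
  by rewrite -union0F.
have treeE : acyclic id F ->
    spanning_tree (port_ends P rt F) (components F) (N :\: I) =
    ((#|F| + #|N :\: I|).+1 == #|V|) &&
    spanning_connected star_ends (star_union F (N :\: I)).
  move=> aF.
  rewrite (@contract_spanning_tree _ _ star_ends _ _ _ (component_kernel F)
    _ _ inr _ x0) //.
  - by rewrite uFS card_union cards0 addn0.
  - by move=> x _; rewrite /port_ends /= imsetU1 imset_set1.
  - by rewrite uFS; apply: wf_union.
  - by rewrite -acE.
apply/idP/idP => [/and3P[aF _]|/andP[cF cFS]]; first by rewrite treeE.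
have aF := acF _ _ FE cFS cF; rewrite aF treeE // cF cFS andbT.
have wfF : well_formed id F.
  move=> e eF; have /eqP/cards2P[x [y [_ ->]]] := simpleE (subsetP FE _ eF).
  by exists x, y.
(* The number of components required by [Psi] follows from the edge count: a forest has
   [#|V| - #|F|] blocks, that is [#|N :\: I| + 1]. *)
have [_] := card_forest wfF; rewrite aF => /esym.
rewrite -(eqP cF) -addnS eqn_add2l => /eqP cb.
have -> : #|components F| = #|N :\: I|.+1 := cb.
by rewrite addn1 cardsD (setIidPr sIN) -/N eqxx.
Qed.

(** The stars of [S] extend, by edges of [E] alone, to a spanning tree. This full support is what
    allows the cancellations in [log_submodular]. *)
Lemma tree_sum_gt0 S : S \subset N -> 0 < tree_sum S.
Proof.
move=> sSN; have [x0 _] := set0Pn _ M_neq0.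
have cE : spanning_connected star_ends (star_union E S).
  apply/spanning_connectedP => x y; apply: (@sub_connect _ _ _ (inl @: E)).
    exact: subsetUl.
  by rewrite -(@connect_relabel _ _ _ id _ _ E).
have sub0E : star_union set0 S \subset star_union E S.
  by apply: setSU; rewrite imset0 sub0set.
have [B [sAB sBE acB cB]] := extend_to_spanning_tree sub0E (stars_acyclic sSN)
  (wf_union (subxx E)) cE.
pose F := inl @^-1: B.
have BE : B = star_union F S.
  apply/setP => -[e|x]; first by rewrite inl_union inE.
  rewrite inr_union; apply/idP/idP => [/(subsetP sBE)|xS].
    by rewrite inr_union.
  by apply: (subsetP sAB); rewrite inr_union.
have FE : F \subset E.
  by apply/subsetP => e; rewrite inE => /(subsetP sBE); rewrite inl_union.
have w_gt0 F' : F' \subset E -> 0 < weight c F'.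
  by move=> F'E; apply: prodr_gt0 => e /(subsetP F'E); apply: c_gt0.
rewrite /tree_sum (bigD1 F) /=.
  by rewrite ltr_wpDr ?w_gt0 // sumr_ge0 // => F' /andP[/andP[/w_gt0/ltW]].
rewrite FE -card_union -BE cB andbT -(connected_acyclic x0 _ cB) ?acB //.
by rewrite BE; apply: wf_union.
Qed.

(** The polynomial is a grounded Laplacian determinant with weights [c] on [E] and [w] on the added
    edges. Since [E] alone is connected with positive conductances, it is nonsingular even where [w]
    vanishes. *)
Lemma tree_sum_stable (w : V -> R[i]) :
  {in N, forall x, complex.Im (w x) <= 0} ->
  {in N, forall x, complex.Im (w x) = 0 -> 0 <= complex.Re (w x)} ->
  gen_poly N (fun S => (tree_sum S)%:C%C) w != 0.
Proof.
move=> imw rew; have [x0 _] := set0Pn _ M_neq0.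
(* Orient the edges arbitrarily. Sets outside [E] get the dummy pair [(x0, x0)], harmless because
   [y] gives them weight 0. *)
have /choice[st stE] : forall e, exists p : V * V, e \in E -> e = [set p.1; p.2].
  move=> e; have [eE|] := boolP (e \in E); last by exists (x0, x0).
  by have /eqP/cards2P[x [y [_ ->]]] := simpleE eE; exists (x, y).
pose s (d : {set V} + V) := match d with inl e => (st e).1 | inr x => root x end.
pose t (d : {set V} + V) := match d with inl e => (st e).2 | inr x => x end.
pose y (d : {set V} + V) : R[i] := match d with
  | inl e => if e \in E then (c e)%:C%C else 0
  | inr x => if x \in N then w x else 0 end.
have ye d : y d != 0 -> star_ends d = [set s d; t d].
  by case: d => //= e; case: ifP => [/stE //|_]; rewrite eqxx.
suff <- : \det (ground_laplacian s t x0 y) = gen_poly N (fun S => (tree_sum S)%:C%C) w.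
  have y_neq0 : {in inl @: E, forall d, y d != 0}.
    move=> _ /imsetP[e eE ->] /=; rewrite eE eq_complex /= negb_and.
    by rewrite gt_eqF // c_gt0.
  apply: (@ground_laplacian_nonsingular _ _ _ star_ends _ _ _ _ (inl @: E)) => //.
  - by move=> d /y_neq0/ye.
  - apply/spanning_connectedP => u v.
    by rewrite -(@connect_relabel _ _ _ id _ _ E).
  - case=> [e|x] /=; first by case: ifP.
    by case: ifP => // /imw.
  - case=> [e|x] /=; first by case: ifP => // /c_gt0/ltW.
    by case: ifP => // /rew.
rewrite (matrix_tree x0 ye) big_mkcond.
(* A set of edges splits into its added part [S] and its trace [F] on [E]; grouping by [S] produces
   the generating polynomial. *)
rewrite (reindex (fun p : {set V} * {set {set V}} => star_union p.2 p.1)) /=; last first.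
  exists (fun T : {set {set V} + V} => (inr @^-1: T, inl @^-1: T)) => [[S F] _|T _] /=.
    by congr (_, _); apply/setP => z; rewrite inE ?inl_union ?inr_union.
  by apply/setP => -[e|x]; rewrite ?inl_union ?inr_union inE.
rewrite -(pair_bigA _ (fun S F =>
  if (#|star_union F S|.+1 == #|V|) && spanning_connected star_ends (star_union F S)
  then \prod_(d in star_union F S) y d else 0)) /=.
rewrite /gen_poly [RHS]big_mkcond; apply: eq_bigr => S _.
have prodE F : \prod_(d in star_union F S) y d =
    (\prod_(e in F) y (inl e)) * \prod_(x in S) y (inr x).
  rewrite big_sumType; congr (_ * _).
    by apply: eq_bigl => e; rewrite inl_union.
  by apply: eq_bigl => x; rewrite inr_union.
case: ifPn => [sSN|/subsetPn[x xS xN]]; last first.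
  rewrite big1 // => F _; case: ifP => // _.
  by rewrite prodE [X in _ * X](bigD1 x) //= (negPf xN) mul0r mulr0.
rewrite rmorph_sum mulr_suml [RHS]big_mkcond; apply: eq_bigr => F _.
rewrite card_union; have [FE|/subsetPn[e eF eE]] /= := boolP (F \subset E); last first.
  by rewrite prodE (bigD1 e) //= (negPf eE) !mul0r; case: ifP.
case: ifP => // _; rewrite prodE rmorph_prod; congr (_ * _).
  by apply: eq_bigr => e eF; rewrite /= (subsetP FE).
by apply: eq_bigr => x xS; rewrite /= (subsetP sSN).
Qed.

End PortNetwork.

(** * Complementation and conclusion *)

(** The monomial of [I] is that of [N] divided by that of [N :\: I]. *)
Lemma gen_poly_compl (K : fieldType) (V : finType) (N : {set V})
    (a : {set V} -> K) (z : V -> K) : {in N, forall i, z i != 0} ->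
  gen_poly N (fun I => a (N :\: I)) z =
  (\prod_(i in N) z i) * gen_poly N a (fun i => (z i)^-1).
Proof.
move=> z0; rewrite /gen_poly big_distrr /=.
rewrite (reindex_onto (fun I => N :\: I) (fun I => N :\: I)) /=; last first.
  by move=> I sIN; rewrite setDDr setDv set0U (setIidPr sIN).
apply: eq_big => [I|I /andP[_ /eqP NI]].
  rewrite subsetDl; apply/eqP/idP => [<-|sIN]; first exact: subsetDl.
  by rewrite setDDr setDv set0U (setIidPr sIN).
rewrite NI; have sIN : I \subset N by rewrite -NI subsetDl.
rewrite mulrCA; congr (_ * _).
rewrite [X in X * _](big_setID I) /= (setIidPr sIN).
rewrite mulrAC -big_split /= [X in X * _]big1 ?mul1r // => i iI.
by rewrite divff ?z0 ?(subsetP sIN).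
Qed.

Theorem corollary5p5 (R : realType) (V : finType)
    (E : {set {set V}}) (c : {set V} -> R)
    (M : {set V}) (P : {set {set V}}) (rt : {set V} -> V)
    (simpleE : simple_graph E) (connE : connected_graph E)
    (c_gt0 : {in E, forall e, 0 < c e})
    (M_neq0 : M != set0) (partP : partition P M)
    (rtP : {in P, forall A, rt A \in A}) :
  let N := nonroots M P rt in
  let PsiN := Psi E c M P rt in
  (forall I J : {set V}, I \subset N -> J \subset N ->
     PsiN I * PsiN J >= PsiN (I :|: J) * PsiN (I :&: J)) /\
  strongly_Rayleigh N (fun I => PsiN I / gen_poly N PsiN (fun=> 1)).
Proof.
move=> N PsiN; pose f := tree_sum E c P rt.
have PsiE (I : {set V}) : I \subset N -> PsiN I = f (N :\: I) by apply: Psi_tree_sum.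
have f_gt0 (S : {set V}) : S \subset N -> 0 < f S by apply: tree_sum_gt0.
have f_stable (w : V -> R[i]) : {in N, forall i, complex.Im (w i) <= 0} ->
    {in N, forall i, complex.Im (w i) = 0 -> 0 <= complex.Re (w i)} ->
    gen_poly N (fun S => (f S)%:C%C) w != 0.
  by move=> imw rew; apply: tree_sum_stable.
split=> [I J IN JN|].
  rewrite !PsiE ?subUset ?IN // ?(subset_trans (subsetIl _ _)) //.
  (* Complementation in [N] exchanges unions and intersections, so it preserves
     log-submodularity. *)
  rewrite setDUr setDIr mulrC.
  by apply: (log_submodular f_gt0 f_stable); apply: subsetDl.
have Psi_gt0 (I : {set V}) : I \subset N -> 0 < PsiN I.
  by move=> IN; rewrite PsiE // f_gt0 // subsetDl.
set Z := gen_poly N PsiN _.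
have ZE : Z = \sum_(I : {set V} | I \subset N) PsiN I.
  by apply: eq_bigr => I _; rewrite big1 ?mulr1.
have Z_gt0 : 0 < Z.
  rewrite ZE (bigD1 N) //= ltr_wpDr ?Psi_gt0 // sumr_ge0 // => I /andP[IN _].
  exact/ltW/Psi_gt0.
split; first split.
- by move=> I IN; rewrite divr_ge0 ?ltW ?Psi_gt0.
- by rewrite -mulr_suml -ZE divff // gt_eqF.
move=> z imz; have z0 : {in N, forall i, z i != 0}.
  by move=> i /imz; apply: contraTneq => ->; rewrite /= ltxx.
have -> : gen_poly N (fun I => (PsiN I / Z)%:C%C) z =
    (Z^-1)%:C%C * gen_poly N (fun I => (f (N :\: I))%:C%C) z.
  rewrite /gen_poly big_distrr; apply: eq_bigr => I IN /=.
  by rewrite PsiE // rmorphM mulrCA mulrA.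
rewrite (gen_poly_compl (fun S => (f S)%:C%C)) // !mulf_neq0 //.
- by rewrite eq_complex /= negb_and invr_eq0 gt_eqF.
- by apply/prodf_neq0.
(* Inversion maps the upper half-plane to the lower one, where [f_stable] applies; the strict sign
   excludes its real case. *)
have imV i : i \in N -> complex.Im (z i)^-1 < 0.
  move=> /imz; case: (z i) => x y /= y0.
  rewrite oppr_lt0 divr_gt0 //.
  by rewrite ltr_wpDl ?sqr_ge0 // exprn_gt0.
apply: f_stable => i iN; first exact/ltW/imV.
by move=> im0; have := imV i iN; rewrite im0 ltxx.
Qed.
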